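(* Let $n$ and $\ell$ be integers with $-1\le\ell\le n-3$, let $t\in\{1,2,\ldots,n-1\}$, and let $G$ be an $n$-vertex graph. Suppose that at least one of the following is true, with the indicated value of $\ell$: (H1) $G$ is not Hamiltonian, and $\ell=0$; (H2) $G$ is not traceable, and $\ell=-1$; (H3) $G$ is not Hamiltonian-connected, and $\ell=1$; (H4) $G$ is not $k$-edge Hamiltonian for some integer $1\le k\le n-3$, and $\ell=k$; (H5) $G$ is not $k$-Hamiltonian for some integer $1\le k\le n-3$, and $\ell=k$. Then, with $i_0=\lfloor\frac{n-1-\ell}{2}\rfloor$, $$s_t(G)\le\max\{s_t(G_n^{\ell}(1)),\,s_t(G_n^{\ell}(i_0))\}.$$ Moreover this bound is tight: in each of the cases (H1)--(H5) and for all admissible parameters, there is an $n$-vertex graph that does not have the corresponding property and for which equality holds.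
   Context: All graphs are finite and simple. $K_m$ is the complete graph and $I_m$ the edgeless graph on $m$ vertices; $\cup$ denotes disjoint union, and $A+B$ denotes the join (disjoint union of $A$ and $B$ together with all edges between them). For integers $n,i,\ell$ with $-1\le\ell\le n-3$ and $1\le i\le\frac{n-1-\ell}{2}$, define $G_n^{\ell}(i)=K_{i+\ell}+(I_i\cup K_{n-2i-\ell})$; when $i+\ell=0$ this is $I_1\cup K_{n-1}$. For $t\ge 1$, $s_t(G)$ is the number of $t$-stars (copies of $K_{1,t}$) in $G$: $s_t(G)=\sum_{v\in V(G)}\binom{d(v)}{t}$ for $t\ge 2$, and $s_1(G)=e(G)=\frac12\sum_{v}d(v)$. A graph is Hamiltonian if it has a Hamilton cycle (spanning cycle), traceable if it has a Hamilton path (spanning path), Hamiltonian-connected if it has a Hamilton path between every pair of distinct vertices. For $k\in\{0,\ldots,n-3\}$, an $n$-vertex graph $G$ is $k$-edge Hamiltonian if every linear forest in $G$ (disjoint union of paths) with at most $k$ edges is contained in a Hamilton cycle of $G$; it is $k$-Hamiltonian if the removal of any set of at most $k$ vertices results in a Hamiltonian graph. *)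

(* Defs.v *)
From HB Require Import structures.
From mathcomp Require Import all_boot all_order all_algebra.

Set Implicit Arguments.
Unset Strict Implicit.
Unset Printing Implicit Defensive.

Record sgraph := SGraph {
  vertex :> finType;
  adj : rel vertex;
  adj_sym : symmetric adj;
  adj_irr : irreflexive adj }.

Definition nbhd (G : sgraph) (v : G) : {set G} := [set x | adj v x].

Definition deg (G : sgraph) (v : G) : nat := #|nbhd v|.

Definition edges (G : sgraph) : {set {set G}} :=
  [set [set p.1; p.2] | p in [set p : G * G | adj p.1 p.2]].

Definition complete_rel m : rel 'I_m := [rel x y | x != y].
Lemma complete_sym m : symmetric (@complete_rel m).
Proof. by move=> x y; rewrite /complete_rel /= eq_sym. Qed.
Lemma complete_irr m : irreflexive (@complete_rel m).
Proof. by move=> x; rewrite /complete_rel /= eqxx. Qed.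
Definition complete m : sgraph := SGraph (@complete_sym m) (@complete_irr m).

Definition edgeless_rel m : rel 'I_m := [rel x y | false].
Lemma edgeless_sym m : symmetric (@edgeless_rel m).
Proof. by []. Qed.
Lemma edgeless_irr m : irreflexive (@edgeless_rel m).
Proof. by []. Qed.
Definition edgeless m : sgraph := SGraph (@edgeless_sym m) (@edgeless_irr m).

(* [cross] tells whether the two sides are fully joined or not joined at all. *)
Definition sum_rel (cross : bool) (A B : sgraph) : rel (A + B)%type :=
  fun x y => match x, y with
  | inl a, inl a' => adj a a'
  | inr b, inr b' => adj b b'
  | _, _ => cross
  end.
Lemma sum_rel_sym cross A B : symmetric (@sum_rel cross A B).
Proof. by move=> [a|b] [a'|b'] //=; apply: adj_sym. Qed.
Lemma sum_rel_irr cross A B : irreflexive (@sum_rel cross A B).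
Proof. by move=> [a|b] /=; apply: adj_irr. Qed.

Definition disjoint_union (A B : sgraph) : sgraph :=
  SGraph (@sum_rel_sym false A B) (@sum_rel_irr false A B).
Definition graph_join (A B : sgraph) : sgraph :=
  SGraph (@sum_rel_sym true A B) (@sum_rel_irr true A B).

Definition delete_rel (G : sgraph) (S : {set G}) : rel {x : G | x \notin S} :=
  fun x y => adj (val x) (val y).
Lemma delete_sym (G : sgraph) (S : {set G}) : symmetric (@delete_rel G S).
Proof. by move=> x y; apply: adj_sym. Qed.
Lemma delete_irr (G : sgraph) (S : {set G}) : irreflexive (@delete_rel G S).
Proof. by move=> x; apply: adj_irr. Qed.
Definition delete_vertices (G : sgraph) (S : {set G}) : sgraph :=
  SGraph (@delete_sym G S) (@delete_irr G S).

(* K_{i+l} + (I_i U K_{n-2i-l}).  It is meant for -1 <= l <= n - 3 and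
   1 <= i <= (n - 1 - l) / 2, where the three sizes are nonnegative, so that the
   absolute values only convert from int to nat.  When i + l = 0 the first
   factor is empty and this is I_1 U K_{n-1}. *)
Definition Gnl (n : nat) (l i : int) : sgraph :=
  graph_join (complete `|(i + l)%R|%N)
    (disjoint_union (edgeless `|i|%N)
       (complete `|(Posz n - 2 * i - l)%R|%N)).

(* A copy of K_{1,t} with t >= 1 has no isolated vertex, so it is identified
   with its set of edges; for t = 1 the two choices of the centre therefore
   give the same copy. *)
Definition star (T : finType) (v : T) (L : {set T}) : {set {set T}} :=
  [set [set v; x] | x in L].

Definition stars (t : nat) (G : sgraph) : {set {set {set G}}} :=
  [set star p.1 p.2 | p in
     [set p : G * {set G} | (p.2 \subset nbhd p.1) && (#|p.2| == t)]].

Definition nstars (t : nat) (G : sgraph) : nat := #|stars t G|.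

Lemma nstars1 (G : sgraph) : nstars 1 G = #|edges G|.
Proof.
rewrite /nstars; apply/esym.
have inj : injective (fun S : {set G} => [set S]) by apply: set1_inj.
rewrite -(card_imset (edges G) inj); apply: eq_card => E.
apply/imsetP/imsetP => [[_ /imsetP[[x y] + ->] ->]|[[x L] + ->]].
  rewrite inE /= => xy; exists (x, [set y]); last by rewrite /star imset_set1.
  by rewrite inE /= sub1set inE xy cards1.
rewrite inE /= andbC => /andP[/cards1P[y ->]]; rewrite sub1set inE => xy.
exists [set x; y]; last by rewrite /star imset_set1.
by apply/imsetP; exists (x, y); rewrite ?inE.
Qed.

Lemma nstarsE (t : nat) (G : sgraph) : 2 <= t ->
  nstars t G = \sum_(v : G) 'C(deg v, t).
Proof.
move=> t2; pose D := [set p : G * {set G} | (p.2 \subset nbhd p.1) && (#|p.2| == t)].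
have memL (v x : G) (L : {set G}) : L \subset nbhd v ->
    (x \in L) = ([set v; x] \in star v L).
  move=> /subsetP LN; apply/idP/imsetP => [xL|[y yL /setP e]]; first by exists x.
  have := e y; have := LN _ yL; rewrite !inE eqxx orbT => vy.
  by case/orP=> /eqP yx; [move: vy; rewrite yx adj_irr | rewrite -yx].
have inj : {in D &, injective (fun p : G * {set G} => star p.1 p.2)}.
  move=> [v L] [w M]; rewrite !inE /= => /andP[Lv /eqP Lt] /andP[Mw _] e.
  suff vw : v = w.
    subst w; congr (_, _); apply/setP => x.
    by rewrite (memL v x L Lv) (memL v x M Mw) e.
  apply/eqP/negPn/negP => vw.
  have Lw (x : G) : x \in L -> x = w.
    rewrite (memL v x L Lv) e => /imsetP[y yM /setP e2].
    by have := e2 w; rewrite !inE eqxx eq_sym (negbTE vw) /= => /eqP.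
  have : #|L| <= #|[set w]|.
    by apply/subset_leq_card/subsetP => x /Lw ->; rewrite inE.
  by rewrite Lt cards1 leqNgt t2.
rewrite /nstars /stars card_in_imset //.
pose Q (v : G) (L : {set G}) := (L \subset nbhd v) && (#|L| == t).
rewrite -sum1_card (eq_bigl (fun p => xpredT p.1 && Q p.1 p.2)); last first.
  by move=> p; rewrite inE.
rewrite -(pair_big_dep xpredT Q (fun _ _ => 1)) /=.
apply: eq_bigr => v _; rewrite sum1_card /deg -(cards_draws (nbhd v) t).
by apply: eq_card => L; rewrite !inE.
Qed.

(* MathComp's [cycle] accepts sequences of fewer than three vertices. *)
Definition hamilton_cycle (G : sgraph) (c : seq G) : bool :=
  [&& 3 <= size c, cycle (@adj G) c, uniq c & [forall x, x \in c]].

Definition hamilton_path (G : sgraph) (p : seq G) : bool :=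
  [&& sorted (@adj G) p, uniq p & [forall x, x \in p]].

Definition hamiltonian (G : sgraph) : Prop :=
  exists c : seq G, hamilton_cycle c.

Definition traceable (G : sgraph) : Prop :=
  exists p : seq G, hamilton_path p.

Definition hamiltonian_connected (G : sgraph) : Prop :=
  forall x y : G, x != y ->
    exists p : seq G, hamilton_path (x :: p) /\ last x p = y.

(* A linear forest is given by the list of its component paths, each path by
   the sequence of its vertices. *)
Definition linear_forest (G : sgraph) (F : seq (seq G)) : bool :=
  [&& [::] \notin F, all (sorted (@adj G)) F & uniq (flatten F)].

Definition forest_size (T : Type) (F : seq (seq T)) : nat :=
  \sum_(p <- F) (size p).-1.

Definition cycle_edge (T : eqType) (c : seq T) : rel T :=
  [rel x y | (next c x == y) || (next c y == x)].

Definition k_edge_hamiltonian (k : nat) (G : sgraph) : Prop :=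
  forall F : seq (seq G), linear_forest F -> forest_size F <= k ->
    exists c : seq G, hamilton_cycle c /\ all (sorted (cycle_edge c)) F.

Definition k_hamiltonian (k : nat) (G : sgraph) : Prop :=
  forall S : {set G}, #|S| <= k -> hamiltonian (delete_vertices S).

(* Main.v *)
Require Import Defs.
From mathcomp Require Import all_boot all_order all_algebra.
From mathcomp Require Import zify.

Set Implicit Arguments.
Unset Strict Implicit.
Unset Printing Implicit Defensive.

(* Each of the five properties follows from the existence of a Hamilton cycle
   through a prescribed list of edges: traceability is Hamiltonicity of the
   cone over [G], and [x]-[y] Hamilton paths are Hamilton cycles through [xy] in
   [G + xy].  By Ore's rotation argument, in an edge-maximal graph without such
   a cycle the degrees of non-adjacent vertices sum to at most [n - 1 + l], and
   Chvatal's argument then yields an [i] such that [i] vertices have degree at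
   most [i + l] and [n - l - i] vertices have degree at most [n - i - 1].
   Hence [\sum_v 'C(d(v), t)] is at most its value on [G_n^l(i)], which is a
   convex function of [i] and so is largest at an end of its range. *)

(** * Convexity and star counts *)

(** Convexity makes the increments nondecreasing, so if the last one is not positive, none before it
    is. *)
Lemma convex_descent (g : nat -> nat) m :
  (forall j, 0 < j -> j.+2 <= m.+1 -> 2 * g j.+1 <= g j + g j.+2) ->
  0 < m -> g m.+1 <= g m -> g m <= g 1.
Proof.
elim: m => [//|[//|m] IHm] convg _ le_g.
have gm : g m.+2 <= g m.+1 by have := convg m.+1 isT (leqnn _); lia.
apply: leq_trans gm _; apply: IHm => // [j j0 jm|].
  by apply: convg => //; lia.
by have := convg m.+1 isT (leqnn _); lia.
Qed.

(** Induction on the right end: if the last step rises, the new end replaces the old one in the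
    maximum; if it falls, [convex_descent] bounds the old end by [g 1]. *)
Lemma convex_le_max (g : nat -> nat) m i :
  (forall j, 0 < j -> j.+2 <= m -> 2 * g j.+1 <= g j + g j.+2) ->
  0 < i <= m -> g i <= maxn (g 1) (g m).
Proof.
elim: m i => [|m IHm] i convg; first by lia.
move=> /andP[i0]; rewrite leq_eqVlt => /orP[/eqP->|im]; first exact: leq_maxr.
have {IHm} := IHm i (fun j j0 jm => convg j j0 (leqW jm)).
rewrite i0 -ltnS im => /(_ isT).
have [gm|gm] := leqP (g m) (g m.+1); first by lia.
have := convex_descent convg (leq_trans i0 im) (ltnW gm); lia.
Qed.

(** By Pascal's rule the increments are ['C(q, t)] and ['C(q.+1, t)]. Naming them turns convexity of
    [extremal_sum] into a polynomial inequality. *)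
Lemma binS_convex q t :
  exists d0 d1, [/\ 'C(q.+1, t.+1) = 'C(q, t.+1) + d0,
    'C(q.+2, t.+1) = 'C(q, t.+1) + d0 + d1 & d0 <= d1].
Proof.
exists 'C(q, t), 'C(q.+1, t); split; rewrite ?binS ?leq_bin2l //; lia.
Qed.

(* The value of [\sum_v 'C(d(v), t)] on [G_n^l(i)], where [m = l + 1]
   is a natural number also for [l = -1]. *)
Definition extremal_sum n m t i :=
  i * 'C(i + m - 1, t) + (n + 1 - m - 2 * i) * 'C(n - i - 1, t)
    + (i + m - 1) * 'C(n - 1, t).

(** The last summand is linear in [i]. In the names used at the end of the proof, the first two have
    second differences [(j + 3) d1 - (j + 1) d0] and [(c + 4) e1 - c e0], nonnegative because
    [d0 <= d1] and [e0 <= e1]. *)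
Lemma extremal_sum_convex n m t j : 0 < t -> 0 < j -> 2 * j.+2 + m <= n ->
  2 * extremal_sum n m t j.+1 <=
    extremal_sum n m t j + extremal_sum n m t j.+2.
Proof.
case: t j => [//|t] [//|j] _ _ jn; rewrite /extremal_sum.
have [d0 [d1 [p1 p2 dd]]] := binS_convex (j + m) t.
have [e0 [e1 [q1 q2 ee]]] := binS_convex (n - j - 4) t.
have -> : j.+1 + m - 1 = j + m by lia.
have -> : j.+2 + m - 1 = (j + m).+1 by lia.
have -> : j.+3 + m - 1 = (j + m).+2 by lia.
have -> : n - j.+1 - 1 = (n - j - 4).+2 by lia.
have -> : n - j.+2 - 1 = (n - j - 4).+1 by lia.
have -> : n - j.+3 - 1 = n - j - 4 by lia.
have -> : n + 1 - m - 2 * j.+1 = n + 1 - m - 2 * j.+3 + 4 by lia.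
have -> : n + 1 - m - 2 * j.+2 = n + 1 - m - 2 * j.+3 + 2 by lia.
rewrite p1 p2 q1 q2.
move: (n + 1 - m - _) => c.
move: 'C(n - 1, _) 'C(j + m, _) 'C(n - j - 4, _) => x y z.
nia.
Qed.

(** As [m = l + 1], the right end [(n - m) %/ 2] is the [i0] of the theorem. *)
Lemma extremal_sum_le_max n m t i : 0 < t -> 0 < i -> 2 * i + m <= n ->
  extremal_sum n m t i <=
    maxn (extremal_sum n m t 1) (extremal_sum n m t ((n - m) %/ 2)).
Proof.
move=> t0 i0 im; apply: convex_le_max => [j j0 jm|]; last by lia.
by apply: extremal_sum_convex => //; lia.
Qed.

(** Ordered adjacent pairs are counted once by first coordinate and once by underlying edge, where
    every fibre is [{(x, y), (y, x)}]. *)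
Lemma sum_deg (G : sgraph) : \sum_(v : G) deg v = #|edges G| * 2.
Proof.
pose D := [set p : G * G | adj p.1 p.2].
transitivity #|D|.
  rewrite -sum1_card (eq_bigl (fun p => xpredT p.1 && adj p.1 p.2)); last first.
    by move=> p; rewrite inE.
  rewrite -(pair_big_dep xpredT (@adj G) (fun _ _ => 1)) /=.
  by apply: eq_bigr => v _; rewrite sum1_card /deg /nbhd; apply: eq_card => x; rewrite !inE.
rewrite -sum1_card (partition_big_imset (fun p : G * G => [set p.1; p.2])) /=.
rewrite -/(edges G) -sum_nat_const; apply: eq_bigr => E /imsetP[[x y]].
rewrite inE /= => xy ->; rewrite sum1_card.
have nxy : x != y by apply: contraTneq xy => ->; rewrite adj_irr.
transitivity #|[set (x, y); (y, x)]|; last first.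
  by rewrite cards2 xpair_eqE negb_and nxy.
apply: eq_card => -[a b]; rewrite -topredE /= !inE /= !xpair_eqE.
apply/andP/orP.
  case=> ab /eqP/setP e; move: (e a) (e b) (e x) (e y).
  rewrite !inE !eqxx /= !orbT (eq_sym x a) (eq_sym x b) (eq_sym y a) (eq_sym y b).
  by case: (a == x); case: (a == y); case: (b == x); case: (b == y); auto.
by case=> /andP[/eqP-> /eqP->]; rewrite ?xy 1?adj_sym ?xy // setUC.
Qed.

(** The factor is 2 for [t = 1], where each edge is seen from both ends, and 1 otherwise. It lets
    all [t] be treated by one degree sum, since scaling does not affect comparisons. *)
Lemma nstars_sum t (G : sgraph) : 0 < t ->
  nstars t G * (t == 1).+1 = \sum_(v : G) 'C(deg v, t).
Proof.
case: t => [//|[|t]] _; last by rewrite muln1 nstarsE.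
by rewrite nstars1 -sum_deg; apply: eq_bigr => v _; rewrite bin1.
Qed.

(** The shape of [Gnl] with natural-number sizes, free of integer casts; [GnlE] makes the link. *)
Definition extremal_graph a b c : sgraph :=
  graph_join (complete a) (disjoint_union (edgeless b) (complete c)).

Lemma sum_extremal_graph a b c t :
  \sum_(v : extremal_graph a b c) 'C(deg v, t) =
  b * 'C(a, t) + c * 'C(a + c - 1, t) + a * 'C(a + b + c - 1, t).
Proof.
rewrite big_sumType /= big_sumType /= addnC.
have cardS (A B : finType) (S : {set A + B}) :
    #|S| = #|[set x | inl x \in S]| + #|[set x | inr x \in S]|.
  rewrite -!sum1_card big_sumType /=; congr (_ + _);
  by apply: eq_bigl => x; rewrite inE.
have cardN (m : nat) (i : 'I_m) : #|[set x : 'I_m | i != x]| = m.-1.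
  by rewrite -[in RHS](card_ord m) -(cardC1 i); apply: eq_card => x; rewrite !inE eq_sym.
have card1 (m : nat) : #|[set x : 'I_m | true]| = m.
  by rewrite -[RHS]card_ord; apply: eq_card => x; rewrite inE.
have card0 (m : nat) : #|[set x : 'I_m | false]| = 0.
  by apply: eq_card0 => x; rewrite inE.
congr (_ + _ + _).
- rewrite (eq_bigr (fun _ => 'C(a, t))) ?sum_nat_const ?card_ord // => v _.
  rewrite /deg /nbhd !cardS; congr 'C(_, t).
  rewrite -[RHS]addn0 -[in RHS](addn0 0); congr (_ + (_ + _)).
  + by rewrite -[RHS]card1; apply: eq_card => x; rewrite !inE.
  + by rewrite -[RHS](card0 b); apply: eq_card => x; rewrite !inE.
  + by rewrite -[RHS](card0 c); apply: eq_card => x; rewrite !inE.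
- rewrite (eq_bigr (fun _ => 'C(a + c - 1, t))) ?sum_nat_const ?card_ord // => v _.
  rewrite /deg /nbhd !cardS; congr 'C(_, t).
  (* With truncated subtraction this needs [0 < c], which the vertex [v] provides. *)
  have -> : a + c - 1 = a + (0 + c.-1) by have := ltn_ord v; lia.
  congr (_ + (_ + _)).
  + by rewrite -[RHS]card1; apply: eq_card => x; rewrite !inE.
  + by rewrite -[RHS](card0 b); apply: eq_card => x; rewrite !inE.
  + by rewrite -(cardN _ v); apply: eq_card => x; rewrite !inE.
- rewrite (eq_bigr (fun _ => 'C(a + b + c - 1, t))) ?sum_nat_const ?card_ord // => v _.
  rewrite /deg /nbhd !cardS; congr 'C(_, t).
  have -> : a + b + c - 1 = a.-1 + (b + c) by have := ltn_ord v; lia.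
  congr (_ + (_ + _)).
  + by rewrite -(cardN _ v); apply: eq_card => x; rewrite !inE.
  + by rewrite -[RHS]card1; apply: eq_card => x; rewrite !inE.
  + by rewrite -[RHS]card1; apply: eq_card => x; rewrite !inE.
Qed.

(** * Hamilton cycles through given edges *)

Lemma next_cat (T : eqType) (a b : seq T) x y :
  uniq (a ++ x :: y :: b) -> next (a ++ x :: y :: b) x = y.
Proof.
by move=> U; rewrite -(next_rot (size a)) // rot_size_cat /= eqxx.
Qed.

Lemma next_rcons (T : eqType) (a : seq T) x y :
  uniq (x :: rcons a y) -> next (x :: rcons a y) y = x.
Proof.
move=> U; have U' : uniq ((x :: a) ++ [:: y]) by rewrite cats1.
rewrite -cats1 -cat_cons -(next_rot (size (x :: a))) // rot_size_cat.
by rewrite /= eqxx.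
Qed.

Lemma cycle_edgeC (T : eqType) (c : seq T) : symmetric (cycle_edge c).
Proof. by move=> x y; rewrite /cycle_edge /= orbC. Qed.

Lemma cycle_edge_cat (T : eqType) (a b : seq T) x y :
  uniq (a ++ x :: y :: b) -> cycle_edge (a ++ x :: y :: b) x y.
Proof. by move=> U; rewrite /cycle_edge /= next_cat ?eqxx. Qed.

Lemma cycle_edge_rot (T : eqType) (c : seq T) i x y :
  uniq c -> cycle_edge (rot i c) x y = cycle_edge c x y.
Proof. by move=> U; rewrite /cycle_edge /= !next_rot. Qed.

(* Unlike [hamilton_cycle], this puts no lower bound on the length. *)
Definition ham_through (T : finType) (e : rel T) (L : seq (T * T)) (c : seq T) :=
  [&& uniq c, [forall x, x \in c], cycle e c
    & all (fun q => cycle_edge c q.1 q.2) L].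

Lemma size_full (T : finType) (c : seq T) :
  uniq c -> (forall x, x \in c) -> size c = #|T|.
Proof. by move=> U F; rewrite -(card_uniqP U); apply: eq_card => x; rewrite F. Qed.

(* The rotation in Ore's argument: reversing the part of the path that starts
   with [w] gives a cycle, which only loses the edge between [s1] and [w]. *)
Lemma ham_through_swap (T : finType) (e : rel T) L u s1 w s2 :
  symmetric e ->
  let p := u :: s1 ++ w :: s2 in
  uniq p -> (forall x, x \in p) -> path e u (s1 ++ w :: s2) ->
  ~~ e u (last w s2) -> all (fun q => e q.1 q.2) L ->
  all (fun q => cycle_edge p q.1 q.2) L ->
  (size s1) \notin [seq minn (index q.1 p) (index q.2 p) | q <- L] ->
  e u w -> e (last w s2) (last u s1) ->
  ham_through e L (u :: s1 ++ rev (w :: s2)).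
Proof.
move=> sym_e p Up Fp; rewrite cat_path => /andP[path1 /= /andP[_ path2]] uv Le Lc Lj uw vs.
have perm_c : perm_eq (u :: s1 ++ rev (w :: s2)) p.
  by rewrite /p perm_cons perm_cat2l perm_rev.
have Uc : uniq (u :: s1 ++ rev (w :: s2)) by rewrite (perm_uniq perm_c).
apply/and4P; split => //.
- by apply/forallP => x; rewrite (perm_mem perm_c).
- rewrite /= rcons_cat cat_path path1 /=.
  rewrite lastI rev_rcons /= (sym_e (last u s1)) vs /= -rev_cons.
  rewrite -[rev _]/(rev (belast u (w :: s2))) -[last w s2]/(last u (w :: s2)).
  by rewrite rev_path /= sym_e uw; rewrite (eq_path (e' := e)).
(* An edge [p_j p_{j+1}] of the path is identified by [j], the smaller index. It survives inside the
   kept prefix if [j < size s1] and inside the reversed part if [j > size s1]. *)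
have step x y : e x y -> next p x = y -> minn (index x p) (index y p) != size s1 ->
    cycle_edge (u :: s1 ++ rev (w :: s2)) x y.
  move=> xy nx; case/splitPr def_p: {-}p / (Fp x) => [a b].
  have Uab : uniq (a ++ x :: b) by rewrite -def_p.
  case: b => [|z b] in def_p Uab *.
    (* If [x] ended the path, its successor [y] would be [u], although [u] is not adjacent to the
       last vertex. *)
    exfalso; case: a => [|u' a] in def_p Uab *.
      by move: (congr1 size def_p); rewrite /p /= size_cat /=; lia.
    have [eu el] : u' = u /\ last w s2 = x.
      by move: (congr1 (last u) def_p); rewrite /= !last_cat /= ; case: def_p => ->.
    have yu : y = u by rewrite -nx def_p cat_cons cats1 next_rcons -?cats1 // eu.
    by case/negP: uv; rewrite sym_e el -yu.
  have ez : z = y by rewrite -nx def_p next_cat.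
  rewrite {}ez in def_p Uab; have ix : index x p = size a.
    have xa : x \notin a by move: Uab; rewrite cat_uniq /= negb_or => /and3P[_ /andP[]].
    by rewrite def_p index_cat (negbTE xa) /= eqxx addn0.
  have iy : index y p = (size a).+1.
    move: Uab; rewrite -cat_rcons => Uab.
    have ya : y \notin rcons a x by move: Uab; rewrite cat_uniq /= negb_or => /and3P[_ /andP[]].
    by rewrite def_p -cat_rcons index_cat (negbTE ya) /= eqxx addn0 size_rcons.
  rewrite ix iy => ne.
  have [lt|ge] := ltnP (size a) (size s1).
    have e1 : u :: s1 = a ++ x :: y :: take (size s1 - (size a).+1) b.
      have : take (size s1).+1 p = u :: s1 by rewrite /p /= take_size_cat.
      move=> <-; rewrite def_p take_cat ltnNge leqW ?(ltnW lt) //=.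
      by have -> : (size s1).+1 - size a = (size s1 - (size a).+1).+2 by lia.
    by move: Uc; rewrite -cat_cons e1 -!catA /=; apply: cycle_edge_cat.
  have e1 : w :: s2 = drop (size s1).+1 a ++ x :: y :: b.
    have : drop (size s1).+1 p = w :: s2 by rewrite /p /= drop_size_cat.
    move=> <-; rewrite def_p drop_cat; case: ltnP => // le.
    have sa : size a = (size s1).+1 by move: ne ge le; clear; lia.
    by rewrite sa subnn drop0 drop_oversize // sa.
  move: Uc; rewrite -cat_cons e1 rev_cat !rev_cons -!cats1 -!catA /= catA.
  by move=> Uc'; rewrite cycle_edgeC; apply: (@cycle_edge_cat _ (u :: s1 ++ rev b)).
apply/allP => -[x y] qL /=; have /= xy := allP Le _ qL.
have /= := map_f (fun q => minn (index q.1 p) (index q.2 p)) qL.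
move=> iL; have ne : minn (index x p) (index y p) != size s1.
  by apply: contraNneq Lj => <-.
have /= /orP[/eqP nx|/eqP nx] := allP Lc _ qL; first exact: step.
by rewrite cycle_edgeC; apply: step; rewrite // 1?sym_e // minnC.
Qed.

(** Let [A] be the positions [j] with [u] adjacent to [p_{j+1}], and [B] those with [v] adjacent to
    [p_j]. A common position would allow a rotation unless the edge lost there is in [L], so the
    overlap is at most [size L], while the union has at most [#|T| - 1] elements. *)
Lemma ore_path (T : finType) (e : rel T) L u p :
  symmetric e -> irreflexive e ->
  uniq (u :: p) -> (forall x, x \in u :: p) -> path e u p ->
  ~~ e u (last u p) -> all (fun q => e q.1 q.2) L ->
  all (fun q => cycle_edge (u :: p) q.1 q.2) L ->
  (forall c, ~~ ham_through e L c) ->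
  #|[set x | e u x]| + #|[set x | e (last u p) x]| < #|T| + size L.
Proof.
move=> sym_e irr_e Up Fp path_p uv Le Lc noham.
set v := last u p in uv *; pose m := size p.
pose A := [set j : 'I_m | e u (nth u p j)].
pose B := [set j : 'I_m | e v (nth u (u :: p) j)].
have leA : #|[set x | e u x]| <= #|A|.
  apply: leq_trans (leq_imset_card (fun j : 'I_m => nth u p j) _).
  apply/subset_leq_card/subsetP => x; rewrite inE => ux.
  have : x \in u :: p by [].
  rewrite inE; case/predU1P => [xu|xp]; first by rewrite xu irr_e in ux.
  apply/imsetP; have ix : index x p < m by rewrite index_mem.
  by exists (Ordinal ix); rewrite ?inE /= nth_index.
have leB : #|[set x | e v x]| <= #|B|.
  apply: leq_trans (leq_imset_card (fun j : 'I_m => nth u (u :: p) j) _).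
  apply/subset_leq_card/subsetP => x; rewrite inE => vx.
  have xp : x \in u :: p by [].
  have ix : index x (u :: p) < m.
    rewrite ltn_neqAle -ltnS -[m.+1]/(size (u :: p)) index_mem xp andbT.
    apply: contraTneq vx => ix; rewrite -(nth_index u xp) ix.
    by rewrite -(last_nth u u p) irr_e.
  apply/imsetP.
  by exists (Ordinal ix); rewrite ?inE /= ?nth_index //
    -[nth _ _ _]/(nth u (u :: p) (index x (u :: p))) nth_index.
have leAB : #|A :&: B| <= size L.
  pose J := [seq minn (index q.1 (u :: p)) (index q.2 (u :: p)) | q <- L].
  rewrite -(size_map (fun q => minn (index q.1 (u :: p)) (index q.2 (u :: p))) L) -/J.
  rewrite cardE -(size_map val); apply: uniq_leq_size.
    by rewrite (map_inj_uniq val_inj) enum_uniq.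
  move=> _ /mapP[j + ->]; rewrite mem_enum !inE => /andP[uw vs].
  have jp := ltn_ord j; apply: contraT => jJ; rewrite -/m in jp.
  have def_p : p = take j p ++ nth u p j :: drop j.+1 p by rewrite -drop_nth // cat_take_drop.
  have sz : size (take j p) = j by rewrite size_take jp.
  have lst : last (nth u p j) (drop j.+1 p) = v by rewrite /v [in RHS]def_p last_cat.
  have lst1 : last u (take j p) = nth u (u :: p) j.
    rewrite [in RHS]def_p -cat_cons nth_cat /= sz ltnSn.
    by rewrite (last_nth u) sz.
  have /negP[] := noham (u :: take j p ++ rev (nth u p j :: drop j.+1 p)).
  by apply: ham_through_swap; rewrite -?def_p ?lst ?lst1 ?sz //.
have leU : #|A :|: B| <= m by rewrite -[m in _ <= m]card_ord max_card.
have AUB := cardsUI A B.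
have : #|T| = m.+1 by rewrite -(size_full Up Fp).
move: #|A| #|B| #|A :&: B| #|A :|: B| AUB leU leA leB leAB; lia.
Qed.

(** * Edge-maximal graphs without the required cycle *)

Definition add_edge (T : eqType) (e : rel T) (u v : T) : rel T :=
  fun a b => [|| e a b, (a == u) && (b == v) | (a == v) && (b == u)].

Lemma add_edge_sym (T : eqType) (e : rel T) u v :
  symmetric e -> symmetric (add_edge e u v).
Proof.
move=> sym_e a b; rewrite /add_edge sym_e; congr orb.
by rewrite orbC !(andbC (b == _)).
Qed.

Lemma add_edge_irr (T : eqType) (e : rel T) u v :
  irreflexive e -> u != v -> irreflexive (add_edge e u v).
Proof.
move=> irr_e uv a; rewrite /add_edge irr_e /= andbC orbb.
by apply: contraNF uv => /andP[/eqP<- /eqP<-].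
Qed.

Lemma add_edgeC (T : eqType) (e : rel T) u v : add_edge e u v =2 add_edge e v u.
Proof. by move=> a b; rewrite /add_edge; congr orb; rewrite orbC. Qed.

(** Rotated to start at [u], the cycle ends at [v]. The first step is not the added edge, since with
    at least three vertices [v] comes later, and the further steps avoid [u]. *)
Lemma open_cycle (T : eqType) (e : rel T) u v c :
  2 < size c -> uniq c -> cycle (add_edge e u v) c -> v \in c -> next c v = u ->
  exists i p, [/\ rot i c = u :: p, path e u p & last u p = v].
Proof.
move=> sz Uc cyc vc nv; have uc : u \in c by rewrite -nv mem_next.
case: (rot_to uc) => i p def_c; exists i, p.
have Up : uniq (u :: p) by rewrite -def_c rot_uniq.
have lastp : last u p = v.
  move: (prev_rot i Uc u); rewrite -{2}nv (prev_next Uc) def_c => <-.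
  rewrite prev_nth mem_head memNindex; last by case/andP: Up.
  by rewrite -last_nth.
split => //.
have szp : 2 < size (u :: p) by rewrite -def_c size_rot.
have : path (add_edge e u v) u p.
  by have := cyc; rewrite -(rot_cycle i) def_c /= rcons_path => /andP[].
case: p => [|z p] in def_c Up lastp szp *; first by [].
have vp : v \in p by rewrite -lastp; case: p szp {def_c Up lastp} => //= a p _; rewrite mem_last.
move: Up => /and3P[]; rewrite inE negb_or => /andP[uz unp] znp Up /= /andP[uz' path_p].
apply/andP; split.
  move: uz'; rewrite /add_edge eqxx /= => /or3P[//|/eqP zv|/andP[_ zu]].
    by rewrite zv vp in znp.
  by rewrite eq_sym zu in uz.
apply: (@sub_in_path _ (predC1 u)) path_p; last first.
  by rewrite /= eq_sym uz; apply/allP => y yp /=; apply: contraNneq unp => <-.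
by move=> a b; rewrite !inE => au bu; rewrite /add_edge (negbTE au) (negbTE bu) andbF !orbF.
Qed.

(** The cycle must use the added edge, or it would already exist in [e]. Cutting it there leaves a
    spanning path with ends [u] and [v], to which [ore_path] applies. *)
Lemma ore_add_edge (T : finType) (e : rel T) L u v c :
  2 < #|T| -> symmetric e -> irreflexive e -> ~~ e u v ->
  all (fun q => e q.1 q.2) L -> (forall c, ~~ ham_through e L c) ->
  ham_through (add_edge e u v) L c ->
  #|[set x | e u x]| + #|[set x | e v x]| < #|T| + size L.
Proof.
move=> T3 sym_e irr_e uv Le noham /and4P[Uc /forallP Fc cyc Lc].
have ncyc : ~~ cycle e c.
  by apply: contra (noham c) => cyc'; apply/and4P; split => //; apply/forallP.
have [x xn] : exists x, ~~ e x (next c x).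
  apply/existsP; rewrite -negb_forall; apply: contra ncyc => /forallP all_e.
  by apply: cycle_from_next => // x _; apply: all_e.
wlog [xv nx] : u v uv cyc / x = v /\ next c x = u.
  move=> gen; have := next_cycle cyc (Fc x).
  rewrite /add_edge (negbTE xn) /= => /orP[] /andP[/eqP xe /eqP ne].
    rewrite addnC; apply: gen => //; first by rewrite sym_e.
    by rewrite -(eq_cycle (add_edgeC e u v)).
  by apply: gen.
rewrite {}xv in nx xn; have sz : 2 < size c by rewrite size_full.
have [i [p [def_c path_p lastp]]] := open_cycle sz Uc cyc (Fc v) nx.
rewrite -lastp; apply: ore_path; rewrite ?lastp -?def_c ?rot_uniq //.
  by move=> y; rewrite mem_rot.
by apply/allP => q qL; rewrite cycle_edge_rot //; apply: (allP Lc).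
Qed.

(** This is all that the bound retains of a failed property. Degrees in [e] are at most those in the
    extension [e'], and the missing edge keeps the degree condition from being vacuous. *)
Definition ore_bounded (T : finType) (m : nat) (e : rel T) : Prop :=
  exists e' : rel T, [/\ symmetric e', irreflexive e', subrel e e',
    exists u v, u != v /\ ~~ e' u v &
    forall u v, u != v -> ~~ e' u v ->
      #|[set x | e' u x]| + #|[set x | e' v x]| < m].

(* An edge-maximal extension of [e] without Hamilton cycle through [L] works. *)
Lemma not_ham_through_ore_bounded (T : finType) (e : rel T) L c0 :
  2 < #|T| -> symmetric e -> irreflexive e -> all (fun q => e q.1 q.2) L ->
  uniq c0 -> (forall x, x \in c0) -> all (fun q => cycle_edge c0 q.1 q.2) L ->
  (forall c, ~~ ham_through e L c) -> ore_bounded (#|T| + size L) e.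
Proof.
move=> T3 sym_e irr_e Le Uc0 Fc0 Lc0 noham.
(* Relations are coded as sets of pairs so that a maximal one can be taken with [maxset_exists]. *)
pose r (E : {set T * T}) : rel T := fun x y => (x, y) \in E.
pose P E := [&& [forall x, forall y, r E x y == r E y x], [forall x, ~~ r E x x]
  & ~~ [exists c : #|T|.-tuple T, ham_through (r E) L c]].
have PP E : reflect [/\ symmetric (r E), irreflexive (r E)
    & forall c, ~~ ham_through (r E) L c] (P E).
  apply: (iffP and3P) => [[/forallP sE /forallP iE nE]|[sE iE nE]]; split.
  - by move=> x y; apply/eqP; move/forallP: (sE x).
  - by move=> x; apply/negbTE.
  - move=> c; apply: contra nE => hc.
    have /and4P[Uc /forallP Fc _ _] := hc.
    have sc : size c == #|T| by rewrite size_full.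
    by apply/existsP; exists (Tuple sc).
  - by apply/forallP => x; apply/forallP => y; rewrite sE.
  - by apply/forallP => x; rewrite iE.
  - by apply/existsP => -[c]; apply/negP.
pose E0 := [set q : T * T | e q.1 q.2].
have rE0 : r E0 =2 e by move=> x y; rewrite /r inE.
have ham_eq e1 e2 c : e1 =2 e2 -> ham_through e1 L c = ham_through e2 L c.
  by move=> e12; rewrite /ham_through (eq_cycle e12).
have P0 : P E0.
  apply/PP; split => [x y|x|c]; rewrite ?rE0 //; by rewrite (ham_eq _ _ _ rE0).
have [E /maxsetP[/PP[sE iE nE] maxE] /subsetP E0E] := maxset_exists P0.
exists (r E); split => //.
- by move=> x y xy; apply: E0E; rewrite inE.
- case: (boolP [exists u, [exists v, (u != v) && ~~ r E u v]]).
    by case/existsP => u /existsP[v /andP[uv nuv]]; exists u, v.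
  (* If every two distinct vertices were adjacent, [c0] itself would be a Hamilton cycle through
     [L]. *)
  move=> complete_E; case/negP: (nE c0); apply/and4P; split => //.
    exact/forallP.
  apply: cycle_from_next => // x xc; apply: contraT => nx.
  case/negP: complete_E; apply/existsP; exists x; apply/existsP.
  exists (next c0 x); rewrite nx andbT.
  case: (rot_to xc) => i p def_c; rewrite -(next_rot i) // def_c.
  have := rot_uniq i c0; have := size_rot i c0; rewrite def_c (size_full Uc0 Fc0) Uc0.
  case: p {def_c} => [|y p] /=; first by move=> szT; rewrite -szT in T3.
  by rewrite eqxx inE negb_or => _ /andP[/andP[]].
- move=> u v uv nuv; pose E1 := (u, v) |: ((v, u) |: E).
  have rE1 : r E1 =2 add_edge (r E) u v.
    by move=> x y; rewrite /r /add_edge !inE !xpair_eqE orbA orbC.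
  have [c hc] : exists c, ham_through (add_edge (r E) u v) L c.
    case: (boolP [exists c : #|T|.-tuple T, ham_through (r E1) L c]).
      by case/existsP => c hc; exists c; rewrite -(ham_eq _ _ _ rE1).
    (* Without such a cycle, adding [uv] would contradict the maximality of [E]. *)
    move=> nE1; have PE1 : P E1.
      apply/and3P; split => //.
        apply/forallP => x; apply/forallP => y; rewrite !rE1.
        by rewrite (add_edge_sym u v sE).
      by apply/forallP => x; rewrite rE1 add_edge_irr.
    have E1E : E1 = E.
      by apply: maxE => //; apply/subsetP => q qE; rewrite !inE qE !orbT.
    by case/negP: nuv; rewrite /r -E1E !inE eqxx.
  have Lr : all (fun q => r E q.1 q.2) L.
    by apply/allP => q qL; apply: E0E; rewrite inE; exact: (allP Le q qL).
  exact: ore_add_edge hc.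
Qed.

(* A non-edge [u v] of maximal degree sum with [d(u) <= d(v)] gives
   [i = d(u) - l], or [i = 1] if [d(u) <= l]. *)
Lemma ore_degree_condition (T : finType) m (e : rel T) :
  let d x := #|[set y | e x y]| in
  symmetric e -> irreflexive e -> m.+2 <= #|T| ->
  (exists u v, u != v /\ ~~ e u v) ->
  (forall u v, u != v -> ~~ e u v -> (d u + d v).+1 < #|T| + m) ->
  exists i, [/\ 0 < i, 2 * i + m <= #|T|, i <= #|[set x | d x < i + m]|
    & #|T| + 1 - m - i <= #|[set x | d x + i < #|T| ]|].
Proof.
move=> d sym_e irr_e mT [u0 [v0 [uv0 nuv0]]] ore.
have [u [v [uv nuv duv max_uv]]] : exists u v, [/\ u != v, ~~ e u v, d u <= d v
    & forall x y, x != y -> ~~ e x y -> d x + d y <= d u + d v].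
  pose P (q : T * T) := (q.1 != q.2) && ~~ e q.1 q.2.
  have P0 : P (u0, v0) by rewrite /P uv0.
  case: (arg_maxnP (fun q : T * T => d q.1 + d q.2) P0) => -[u v] /andP[/= uv nuv] max_uv.
  have max' x y : x != y -> ~~ e x y -> d x + d y <= d u + d v.
    by move=> xy nxy; apply: (max_uv (x, y)); apply/andP.
  case: (leqP (d u) (d v)) => duv; first by exists u, v.
  exists v, u; split; rewrite 1?eq_sym 1?sym_e 1?ltnW // => x y xy nxy.
  by rewrite [leqRHS]addnC max'.
have cardN x : #|[set y | ~~ e x y]| = #|T| - d x.
  by rewrite -(cardsC [set y | e x y]) addKn; apply: eq_card => y; rewrite !inE.
have leN x : d x <= #|T| by apply: max_card.
have ltN x y : x != y -> ~~ e x y -> d x + 2 <= #|T|.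
  move=> xy nxy; rewrite -(cardsC [set y | e x y]) leq_add2l.
  have <- : #|[set x; y]| = 2 by rewrite cards2 xy.
  apply/subset_leq_card/subsetP => z; rewrite !inE.
  by case/orP=> /eqP->; rewrite ?irr_e.
have ouv := ore u v uv nuv.
have [small|big] := leqP (d u).+1 m.
  (* Here [u] is the one vertex of low degree, and the non-neighbours of [u], including [u], have
     degree at most [#|T| - 2]. *)
  exists 1; split => //.
    by rewrite card_gt0; apply/set0Pn; exists u; rewrite inE; lia.
  apply: leq_trans (_ : #|[set y | ~~ e u y]| <= _); first by rewrite cardN; lia.
  apply/subset_leq_card/subsetP => x; rewrite !inE => nux; rewrite addn1 -addn1.
  have [->|xu] := eqVneq x u; first by have := ltN u v uv nuv; lia.
  by have := ltN x u xu; rewrite sym_e => /(_ nux); lia.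
have dv := ltN v u; rewrite eq_sym sym_e in dv; have {}dv := dv uv nuv.
exists ((d u).+1 - m); split; try lia.
  (* By maximality of the degree sum, each non-neighbour of [v] other than [v] has degree at most
     [d u = i + m - 1]. *)
  apply: leq_trans (_ : #|[set y | ~~ e v y] :\ v| <= _).
    have := cardsD1 v [set y | ~~ e v y]; rewrite inE irr_e cardN; lia.
  apply/subset_leq_card/subsetP => x; rewrite !inE => /andP[xv nvx].
  by have := max_uv x v xv; rewrite sym_e => /(_ nvx); lia.
(* Likewise the non-neighbours of [u], and [u] itself, have degree at most [d v], which is less than
   [#|T| - i]. *)
apply: leq_trans (_ : #|[set y | ~~ e u y]| <= _); first by rewrite cardN; lia.
apply/subset_leq_card/subsetP => x; rewrite !inE => nux.
have [->|xu] := eqVneq x u; first by lia.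
by have := max_uv x u xu; rewrite sym_e => /(_ nux); lia.
Qed.

(** * Bounding the degree sum *)

(** Summation by layers: every vertex pays [c1], those outside [A] also [c2 - c1], those outside [B]
    also [c3 - c2]. Hence lower bounds on [#|A|] and [#|B|] suffice. *)
Lemma sum_bin_le_extremal (T : finType) (d : T -> nat) m t i :
  let n := #|T| in
  0 < i -> 2 * i + m <= n -> (forall x, d x < n) ->
  i <= #|[set x | d x < i + m]| -> n + 1 - m - i <= #|[set x | d x + i < n]| ->
  \sum_x 'C(d x, t) <= extremal_sum n m t i.
Proof.
move=> n i0 im dn; set A := [set x | _]; set B := [set x | _] => leA leB.
have AB : A \subset B by apply/subsetP => x; rewrite !inE; lia.
pose c1 := 'C(i + m - 1, t); pose c2 := 'C(n - i - 1, t); pose c3 := 'C(n - 1, t).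
have c12 : c1 <= c2 by apply: leq_bin2l; lia.
have c23 : c2 <= c3 by apply: leq_bin2l; lia.
have le1 x : 'C(d x, t) <= c1 + (x \notin A) * (c2 - c1) + (x \notin B) * (c3 - c2).
  rewrite /c1 /c2 /c3 in c12 c23 *.
  have [xA|xA] := boolP (x \in A).
    have := xA; rewrite !inE => dx; apply: leq_trans (_ : 'C(i + m - 1, t) <= _); last by lia.
    by apply: leq_bin2l; lia.
  have [|xB] := boolP (x \in B).
    rewrite inE => dx; apply: leq_trans (_ : 'C(n - i - 1, t) <= _); last by lia.
    by apply: leq_bin2l; lia.
  apply: leq_trans (_ : 'C(n - 1, t) <= _); last by lia.
  by apply: leq_bin2l; have := dn x; lia.
apply: leq_trans (leq_sum _ (fun x _ => le1 x)) _.
have cardC (S : {set T}) : \sum_x (x \notin S : nat) = n - #|S|.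
  rewrite /n -(cardsC S) addKn -sum1_card [RHS]big_mkcond /=.
  by apply: eq_bigr => x _; rewrite inE; case: (x \in S).
rewrite !big_split /= -!big_distrl /= !cardC sum_nat_const -/n.
have leAn : #|A| <= n by apply: max_card.
have leBn : #|B| <= n by apply: max_card.
rewrite /extremal_sum -/c1 -/c2 -/c3.
apply: leq_trans (_ : n * c1 + (n - i) * (c2 - c1) + (i + m - 1) * (c3 - c2) <= _).
  by rewrite leq_add ?leq_add // leq_mul //; lia.
move: c1 c2 c3 {le1} c12 c23 => c1 c2 c3 c12 c23.
move: (c3 - c2) (subnKC c23) (c2 - c1) (subnKC c12) => y <- x <-.
have -> : n - i = (n + 1 - m - 2 * i) + (i + m - 1) by move: im i0; clear; lia.
rewrite {1}(_ : n = i + (n + 1 - m - 2 * i) + (i + m - 1)); last by move: im i0; clear; lia.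
move: (n + 1 - m - _) (i + m - 1) => p q. by nia.
Qed.

(** With [m = l + 1], the threshold [k] is [n + l]. Degrees only grow from [G] to the extension,
    where the degree condition supplies [i]. *)
Lemma ore_bounded_sum (G : sgraph) m k t :
  m.+2 <= #|G| -> k.+1 = #|G| + m -> 0 < t -> ore_bounded k (@adj G) ->
  \sum_(v : G) 'C(deg v, t) <= maxn (extremal_sum #|G| m t 1)
    (extremal_sum #|G| m t ((#|G| - m) %/ 2)).
Proof.
move=> mG km t0 [e [sym_e irr_e sub_e nonedge ore]].
have [|i [i0 im low high]] := ore_degree_condition sym_e irr_e mG nonedge.
  by move=> u v uv nuv; rewrite -km ltnS; apply: ore.
apply: leq_trans (extremal_sum_le_max t0 i0 im).
apply: leq_trans (sum_bin_le_extremal t i0 im _ low high) => [|x].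
  apply: leq_sum => v _; apply/leq_bin2l/subset_leq_card/subsetP => x.
  by rewrite !inE; apply: sub_e.
rewrite -cardsT; apply/proper_card/properP; split; first exact: subsetT.
by exists x; rewrite ?inE ?irr_e.
Qed.

(** * From degree sums to the five properties *)

Lemma ore_boundedW (T : finType) (e : rel T) k m :
  k <= m -> ore_bounded k e -> ore_bounded m e.
Proof.
move=> km [e' [? ? ? ? ore]]; exists e'; split=> // u v uv nuv.
by apply: leq_trans km; apply: ore.
Qed.

(** A spanning cycle is a tuple of length [#|T|], so the search is finite and the case distinction
    constructive. *)
Lemma ham_through_dec (T : finType) (e : rel T) L :
  (exists c, ham_through e L c) \/ (forall c, ~~ ham_through e L c).
Proof.
case: (boolP [exists c : #|T|.-tuple T, ham_through e L c]) => [|nham].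
  by case/existsP => c hc; left; exists c.
right=> c; apply: contra nham => hc; have /and4P[Uc /forallP Fc _ _] := hc.
have sc : size c == #|T| by rewrite size_full.
by apply/existsP; exists (Tuple sc).
Qed.

Lemma hamiltonian_of_ore (G : sgraph) :
  2 < #|G| -> ~ ore_bounded #|G| (@adj G) -> hamiltonian G.
Proof.
move=> G3 nore; have [[c /and4P[Uc Fc cyc _]]|noham] := ham_through_dec (@adj G) [::].
  by exists c; apply/and4P; split => //; rewrite size_full //; apply/forallP.
case: nore; rewrite -[#|G|]addn0 -[0]/(size (@nil (G * G))).
apply: (@not_ham_through_ore_bounded _ _ _ (enum G)) => //.
- exact: adj_sym.
- exact: adj_irr.
- exact: enum_uniq.
- by move=> x; rewrite mem_enum.
Qed.

Definition cone_rel (T : finType) (e : rel T) : rel (option T) :=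
  fun x y => match x, y with
  | Some a, Some b => e a b
  | None, None => false
  | _, _ => true
  end.

Lemma cone_sym (G : sgraph) : symmetric (cone_rel (@adj G)).
Proof. by move=> [a|] [b|] //=; apply: adj_sym. Qed.

Lemma cone_irr (G : sgraph) : irreflexive (cone_rel (@adj G)).
Proof. by move=> [a|] //=; apply: adj_irr. Qed.

Definition cone (G : sgraph) : sgraph := SGraph (@cone_sym G) (@cone_irr G).

(** Removing the apex [None] opens a Hamilton cycle of the cone into a Hamilton path of [G];
    conversely the apex joins the two ends of a path. *)
Lemma cone_hamiltonian (G : sgraph) :
  2 <= #|G| -> hamiltonian (cone G) <-> traceable G.
Proof.
move=> G2; split=> [[c /and4P[_ cyc Uc /forallP Fc]]|[p /and3P[sp Up /forallP Fp]]].
  case: (rot_to (Fc None)) => i q def_c.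
  have Uq : uniq (None :: q) by rewrite -def_c rot_uniq.
  have [p def_q] : exists p : seq G, q = map Some p.
    exists (pmap id q); rewrite -[LHS]map_id.
    case/andP: Uq; elim: q {def_c} => //= x q IHq; rewrite inE negb_or => /andP[nx nq] /andP[_ Uq].
    by case: x nx => //= x _; rewrite -IHq // map_id.
  exists p; apply/and3P; split.
  - move: cyc; rewrite -(rot_cycle i) def_c def_q /= rcons_path => /andP[+ _].
    by case: p {def_q} => //= x p; rewrite path_map.
  - by move: Uq; rewrite def_q /= (map_inj_uniq (@Some_inj _)) => /andP[].
  - apply/forallP => x; have := Fc (Some x).
    by rewrite -(mem_rot i) def_c inE /= def_q mem_map //; apply: Some_inj.
exists (None :: map Some p); apply/and4P; split.
- by rewrite /= size_map size_full.
- have : 0 < size p by rewrite (size_full Up Fp) ltnW.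
  case: p sp {Up Fp} => [|x p] //= sp _; rewrite rcons_path path_map.
  by apply/andP; split; [apply: sub_path sp | rewrite last_map].
- rewrite /= (map_inj_uniq (@Some_inj _)) Up andbT.
  by apply/mapP => -[].
- apply/forallP => -[x|]; rewrite inE //=.
  by rewrite mem_map //; apply: Some_inj.
Qed.

(** The apex is adjacent to everything, so non-edges of the extended cone lie in [G]. Dropping the
    apex lowers each of the two degrees by one, which turns the threshold [#|G| + 1] into
    [#|G| - 1]. *)
Lemma traceable_of_ore (G : sgraph) k :
  2 <= #|G| -> k.+1 = #|G| -> ~ ore_bounded k (@adj G) -> traceable G.
Proof.
move=> G2 kG nore; rewrite -cone_hamiltonian //.
have cardG : #|cone G| = #|G|.+1 by rewrite card_option.
apply: hamiltonian_of_ore; rewrite cardG //; apply: contra_not nore.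
case=> e [sym_e irr_e sub_e [u0 [v0 [uv0 nuv0]]] ore].
have eNone a : e None (Some a) by apply: sub_e.
have degS a : #|[set y | e (Some a) y]| = #|[set y | e (Some a) (Some y)]|.+1.
  rewrite (cardsD1 None) inE sym_e eNone add1n; congr S.
  rewrite -(card_imset _ (f := @Some G)); last by move=> x y [].
  apply: eq_card => y; rewrite !inE.
  apply/andP/imsetP => [|[b + ->]]; last by rewrite inE.
  by case: y => [b|] [] // _ ab; exists b; rewrite ?inE.
exists (fun x y => e (Some x) (Some y)); split.
- by move=> x y; apply: sym_e.
- by move=> x; apply: irr_e.
- by move=> x y xy; apply: sub_e.
- case: u0 v0 uv0 nuv0 => [u|] [v|] //= uv; last by rewrite eNone.
    by exists u, v.
  by rewrite sym_e eNone.
- move=> u v uv nuv; have := ore (Some u) (Some v) uv nuv.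
  by rewrite !degS; lia.
Qed.

(** A Hamilton cycle of [G + xy] through [xy] is sought; the single prescribed edge raises the
    threshold by one. *)
Lemma hamiltonian_connected_of_ore (G : sgraph) :
  2 < #|G| -> ~ ore_bounded #|G|.+1 (@adj G) -> hamiltonian_connected G.
Proof.
move=> G3 nore x y xy; pose e := add_edge (@adj G) x y.
have sym_e : symmetric e by apply/add_edge_sym/adj_sym.
have irr_e : irreflexive e by apply: add_edge_irr => //; apply: adj_irr.
have [[c /and4P[Uc /forallP Fc cyc]]|noham] := ham_through_dec e [:: (x, y)].
  rewrite /= andbT => /orP xyc; have sz : 2 < size c by rewrite size_full.
  have pathP u v : cycle (add_edge (@adj G) u v) c -> next c v == u ->
      exists p : seq G, hamilton_path (u :: p) /\ last u p = v.
    move=> cyc' /eqP nv; have [i [p [def_c path_p lastp]]] := open_cycle sz Uc cyc' (Fc v) nv.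
    exists p; split => //; apply/and3P; split; rewrite // -def_c ?rot_uniq //.
    by apply/forallP => z; rewrite mem_rot.
  (* If the cycle goes from [y] to [x], cutting gives the path from [x] to [y]; otherwise the path
     obtained is reversed. *)
  case: xyc => [xyc|yxc]; last exact: pathP.
  rewrite (eq_cycle (add_edgeC _ x y)) in cyc.
  have [p [/and3P[sp Up /forallP Fp] lastp]] := pathP _ _ cyc xyc.
  have def_p : rev (y :: p) = x :: rev (belast y p) by rewrite lastI rev_rcons lastp.
  exists (rev (belast y p)); rewrite -def_p; split; last first.
    by rewrite -[last x _]/(last x (x :: rev (belast y p))) -def_p rev_cons last_rcons.
  apply/and3P; split; rewrite ?rev_uniq //.
    by rewrite rev_sorted; apply: sub_sorted sp => a b; rewrite adj_sym.
  by apply/forallP => z; rewrite mem_rev.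
case: nore; have [||||e' [? ? sub ? ?]] := not_ham_through_ore_bounded
  (c0 := [:: x; y] ++ [seq z <- enum G | (z != x) && (z != y)])
  G3 sym_e irr_e _ _ _ _ noham.
- by rewrite /e /add_edge /= !eqxx orbT.
- rewrite /= inE mem_filter (negbTE xy) eqxx /= !mem_filter eqxx andbF /=.
  exact: filter_uniq (enum_uniq _).
- move=> z; rewrite mem_cat mem_filter mem_enum !inE.
  by case: (z == x); case: (z == y).
- by rewrite /= andbT /cycle_edge /= eqxx eqxx.
exists e'; split => //; last by rewrite -addn1.
by move=> a b ab; apply: sub; rewrite /e /add_edge ab.
Qed.

Definition seq_pairs (T : Type) (s : seq T) : seq (T * T) := zip s (behead s).

Lemma size_seq_pairs (T : Type) (s : seq T) : size (seq_pairs s) = (size s).-1.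
Proof. by rewrite size_zip size_behead; lia. Qed.

Lemma sorted_pairs (T : Type) (r : rel T) (s : seq T) :
  sorted r s = all (fun q => r q.1 q.2) (seq_pairs s).
Proof. by case: s => //= x s; elim: s x => //= y s IHs x; rewrite IHs. Qed.

Lemma sorted_cycle_edge (T : eqType) (a f b : seq T) :
  uniq (a ++ f ++ b) -> sorted (cycle_edge (a ++ f ++ b)) f.
Proof.
case: f => //= x f; elim: f a x => //= y f IHf a x U; rewrite cycle_edge_cat //=.
by move: U; rewrite -cat_rcons; apply: IHf.
Qed.

(** [L] lists the edges of the forest. The order [c0] puts its components one after another before
    the remaining vertices, so each component is a segment of [c0]. *)
Lemma k_edge_hamiltonian_of_ore (G : sgraph) k :
  2 < #|G| -> ~ ore_bounded (#|G| + k) (@adj G) -> k_edge_hamiltonian k G.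
Proof.
move=> G3 nore F /and3P[_ sF UF] sizeF; pose L := flatten (map (@seq_pairs G) F).
have allL (r : rel G) : all (fun q => r q.1 q.2) L = all (sorted r) F.
  rewrite /L; elim: (F) => //= f F' IHF; rewrite all_cat IHF; congr andb.
  by rewrite sorted_pairs.
have sizeL : size L <= k.
  apply: leq_trans sizeF; rewrite /L /forest_size size_flatten /shape -map_comp sumnE big_map.
  by apply: leq_sum => f _; rewrite /= size_seq_pairs.
have [[c /and4P[Uc Fc cyc]]|noham] := ham_through_dec (@adj G) L.
  rewrite allL => ?; exists c; split => //; apply/and4P; split => //.
  by rewrite size_full //; apply/forallP.
case: nore; apply: (@ore_boundedW _ _ (#|G| + size L)); first by rewrite leq_add2l.
pose c0 := flatten F ++ [seq z <- enum G | z \notin flatten F].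
have Uc0 : uniq c0.
  rewrite cat_uniq UF filter_uniq ?enum_uniq // andbT; apply/hasPn => z.
  by rewrite mem_filter => /andP[].
apply: (@not_ham_through_ore_bounded _ _ _ c0); rewrite ?allL //.
- exact: adj_sym.
- exact: adj_irr.
- by move=> z; rewrite mem_cat mem_filter mem_enum andbT orbN.
apply/allP => f fF; case/splitPr def_F: F / fF => [F1 F2].
move: Uc0; rewrite /c0 def_F flatten_cat /= -!catA.
exact: sorted_cycle_edge.
Qed.

(** The extension of [G - S] becomes one of [G] by making the vertices of [S] adjacent to all
    others. Each degree outside [S] grows by at most [#|S|], so the threshold goes from
    [#|G| - #|S|] to [#|G| + #|S|]. *)
Lemma k_hamiltonian_of_ore (G : sgraph) k :
  k + 3 <= #|G| -> ~ ore_bounded (#|G| + k) (@adj G) -> k_hamiltonian k G.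
Proof.
move=> G3 nore S Sk; have cardG : #|delete_vertices S| = #|G| - #|S|.
  rewrite card_sig -(cardsC S) addKn; apply: eq_card => x; rewrite !inE.
  by [].
apply: hamiltonian_of_ore; rewrite cardG; first by lia.
apply: contra_not nore => -[e [sym_e irr_e sub_e [u0 [v0 [uv0 nuv0]]] ore]].
pose f (x : G) : option (delete_vertices S) := insub x.
pose e' (x y : G) := match f x, f y with
  | Some a, Some b => e a b
  | _, _ => x != y
  end.
have fval (a : delete_vertices S) : f (val a) = Some a by apply: valK.
have fP x : f x = None \/ exists a, f x = Some a /\ x = val a.
  rewrite /f; case: insubP => [a _ <-|_]; first by right; exists a.
  by left.
have degS (a : delete_vertices S) : #|[set y | e' (val a) y]| <= #|[set b | e a b]| + #|S|.
  rewrite -(card_imset _ (@val_inj _ _ (delete_vertices S))).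
  apply: leq_trans (leq_card_setU _ _).
  apply/subset_leq_card/subsetP => y; rewrite !inE /e' fval.
  case: (boolP (y \in S)) => [|yS]; first by rewrite orbT.
  rewrite orbF /f insubT => ab; apply/imsetP; exists (Sub y yS); rewrite ?inE //.
exists e'; split.
- move=> x y; rewrite /e' eq_sym.
  by case: (f x) => [a|]; case: (f y) => [b|] //=; apply: sym_e.
- move=> x; rewrite /e'; case: (f x) => [a|]; rewrite ?eqxx //; exact: irr_e.
- move=> x y xy; rewrite /e'.
  have nxy : x != y by apply: contraTneq xy => ->; rewrite adj_irr.
  have [->|[a [-> xa]]] := fP x; first by [].
  have [->|[b [-> yb]]] := fP y; first by [].
  by apply: sub_e; move: xy; rewrite xa yb.
- exists (val u0), (val v0); rewrite /e' !fval; split => //.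
- move=> u v uv nuv.
  have [fu|[a [_ ua]]] := fP u; first by move: nuv; rewrite /e' fu uv.
  have [fv|[b [_ vb]]] := fP v; first by move: nuv; rewrite /e' fv uv; case: (f u).
  have nab : ~~ e a b by move: nuv; rewrite /e' ua vb !fval.
  have ab : a != b by apply: contraNneq uv => ab; rewrite ua vb ab.
  have cS : #|S| <= #|G| := max_card (mem S).
  rewrite ua vb; have := ore a b ab nab; have := degS a; have := degS b; lia.
Qed.

(** * The extremal graphs *)

(* In the cycle, [Y] sends [#|Y|] edges back into [X], so these and the [k]
   steps inside [X] account for the successors of all vertices of [X]; hence
   [X :|: Y] is closed under successors. *)
Lemma no_spanning_cycle (T : finType) (e : rel T) (X Y : {set T}) z c k :
  symmetric e -> uniq c -> (forall x, x \in c) -> cycle e c ->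
  (forall x y, y \in Y -> e y x -> x \in X) -> [disjoint X & Y] ->
  0 < #|Y| -> #|X| <= #|Y| + k -> z \notin X :|: Y ->
  k <= #|[set x in X | next c x \in X]| -> False.
Proof.
move=> sym_e Uc Fc cyc YX dXY Y0 XYk zW; set XX := [set x in X | _] => kXX.
pose XY := [set x in X | next c x \in Y].
(* The predecessor of a vertex of [Y] is a neighbour of it, hence in [X], and distinct vertices have
   distinct predecessors. *)
have YXY : #|Y| <= #|XY|.
  rewrite -(card_imset _ (can_inj (next_prev Uc))).
  apply/subset_leq_card/subsetP => _ /imsetP[y yY ->].
  rewrite inE next_prev // yY andbT; apply: (YX _ y) => //.
  by rewrite sym_e; apply: prev_cycle.
have dXXY : XX :&: XY = set0.
  apply/setP => x; rewrite !inE; apply/negP => /andP[/andP[_ xX] /andP[_ xY]].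
  by rewrite (disjointFr dXY xX) in xY.
have XE : XX :|: XY = X.
  apply/eqP; rewrite eqEcard; apply/andP; split.
    by apply/subsetP => x; rewrite !inE => /orP[] /andP[].
  by rewrite cardsU dXXY cards0 subn0; lia.
have closedW x : x \in X :|: Y -> next c x \in X :|: Y.
  rewrite inE => /orP[|xY]; first by rewrite -{1}XE !inE => /orP[] /andP[_ ->]; rewrite ?orbT.
  by rewrite inE (YX _ x) //; apply: next_cycle.
have /set0Pn[y yY] : Y != set0 by rewrite -card_gt0.
(* A spanning cycle is a single orbit of [next], so the closed set [X :|: Y] would contain [z]. *)
have yz : fconnect (next c) y z by rewrite (fconnect_cycle (cycle_next Uc) (Fc y)).
case/negP: zW; rewrite -(iter_findex yz).
elim: (findex _ _ _) => [|j IHj] /=; first by rewrite inE yY orbT.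
exact: closedW.
Qed.

(** Each edge of [f] is a step of the cycle in one direction. Prepending [a] adds a new source: [a]
    if the step goes to [b], and otherwise [b], whose successor [a] was not in the shorter path. *)
Lemma card_cycle_edge_sources (T : finType) (c f : seq T) :
  uniq c -> uniq f -> sorted (cycle_edge c) f ->
  (size f).-1 <= #|[set x in f | next c x \in f]|.
Proof.
move=> Uc; case: f => // a f; elim: f a => // b f IHf a.
rewrite [size _]/= -[_.-1]/(size f).+1 => /= /andP[af Uf] /andP[ab sf].
have {IHf} := IHf b Uf sf => /= IHf.
set B := [set x in b :: f | next c x \in b :: f] in IHf *.
apply: leq_ltn_trans IHf _; apply/proper_card/properP; split.
  apply/subsetP => x; rewrite [x \in B]inE [in X in _ -> X]inE => /andP[xf nf].
  by rewrite !(in_cons a) xf nf !orbT.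
case/orP: ab => /eqP ab.
  exists a; last by rewrite inE (negbTE af).
  by rewrite inE ab !inE !eqxx orbT.
by exists b; rewrite inE ab ?(negbTE af) ?andbF // !inE !eqxx orbT.
Qed.

Definition clique_part a b c : {set extremal_graph a b c} :=
  [set x | if x is inl _ then true else false].

Definition independent_part a b c : {set extremal_graph a b c} :=
  [set x | if x is inr (inl _) then true else false].

Lemma card_clique_part a b c : #|clique_part a b c| = a.
Proof.
rewrite -[RHS]card_ord -(card_imset _ (f := inl : 'I_a -> extremal_graph a b c));
  last by move=> x y [].
apply: eq_card => -[x|x]; rewrite inE; first by rewrite mem_imset //; move=> ? ? [].
by apply/esym/imsetP => -[].
Qed.

Lemma card_independent_part a b c : #|independent_part a b c| = b.
Proof.
pose h (j : 'I_b) : extremal_graph a b c := inr (inl j).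
have injh : injective h by move=> x y [].
rewrite -[RHS]card_ord -(card_imset _ injh).
apply: eq_card => -[x|[x|x]]; rewrite inE.
- by apply/esym/imsetP => -[].
- by apply/esym/imsetP; exists x.
- by apply/esym/imsetP => -[].
Qed.

Lemma card_extremal_graph a b c : #|extremal_graph a b c| = a + b + c.
Proof. by rewrite card_sum card_sum !card_ord addnA. Qed.

Lemma disjoint_parts a b c : [disjoint clique_part a b c & independent_part a b c].
Proof. by apply/pred0P => -[x|x]; rewrite /= !inE. Qed.

Lemma independent_part_nbhd a b c (x y : extremal_graph a b c) :
  y \in independent_part a b c -> adj y x -> x \in clique_part a b c.
Proof. by rewrite !inE; case: y x => [y|[y|y]] [x|[x|x]]. Qed.

Lemma exists_other_part a b c : 0 < c ->
  exists z, z \notin clique_part a b c :|: independent_part a b c.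
Proof. by case: c => // c _; exists (inr (inr ord0)); rewrite !inE. Qed.

Lemma no_extremal_cycle a b c k (s : seq (extremal_graph a b c)) :
  0 < b -> 0 < c -> a <= b + k -> hamilton_cycle s ->
  k <= #|[set x in clique_part a b c | next s x \in clique_part a b c]| -> False.
Proof.
move=> b0 c0 abk /and4P[_ cyc Us /forallP Fs] ks.
have [z zW] := exists_other_part a b c0.
apply: (no_spanning_cycle (@adj_sym _) Us Fs cyc _ _ _ _ zW ks).
- by move=> x y; apply: independent_part_nbhd.
- exact: disjoint_parts.
- by rewrite card_independent_part.
- by rewrite card_independent_part card_clique_part.
Qed.

Lemma extremal_not_hamiltonian a b c : 0 < b -> 0 < c -> a <= b ->
  ~ hamiltonian (extremal_graph a b c).
Proof.
by move=> b0 c0 ab [s hs]; apply: (no_extremal_cycle (k := 0) b0 c0 _ hs); rewrite ?addn0.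
Qed.

(** In the cone the apex joins the clique side, which then has [a + 1 <= b] vertices. *)
Lemma extremal_not_traceable a b c : 0 < b -> 0 < c -> a < b ->
  ~ traceable (extremal_graph a b c).
Proof.
move=> b0 c0 ab; rewrite -cone_hamiltonian; last by rewrite card_extremal_graph; lia.
case=> s /and4P[_ cyc Us /forallP Fs]; have [z zW] := exists_other_part a b c0.
set G := extremal_graph a b c in s cyc Us Fs z zW.
have injS : injective (@Some G) by move=> x y [].
pose X : {set cone G} := None |: @Some G @: clique_part a b c.
pose Y : {set cone G} := @Some G @: independent_part a b c.
have cardY : #|Y| = b by rewrite card_imset // card_independent_part.
apply: (@no_spanning_cycle _ _ X Y (Some z) s 0 (@adj_sym _) Us Fs cyc) => //.
- move=> x _ /imsetP[y yY ->]; rewrite !inE; case: x => [x|] //= yx.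
  by rewrite mem_imset //; apply: independent_part_nbhd yx.
- apply/pred0P => -[x|] /=; rewrite !inE /=.
    by rewrite !mem_imset //; apply: (pred0P (disjoint_parts a b c)).
  by apply/imsetP => -[].
- by rewrite cardY.
- rewrite cardY addn0; apply: leq_trans (leq_card_setU _ _) _.
  by rewrite cards1 card_imset // card_clique_part.
- by move: zW; rewrite !in_setU in_set1 /= !mem_imset.
Qed.

(** Both ends are chosen in the clique part, so closing the path creates one step inside it, which
    uses up the surplus [a - b = 1]. *)
Lemma extremal_not_hamiltonian_connected a b c : 0 < b -> 0 < c -> a = b.+1 ->
  ~ hamiltonian_connected (extremal_graph a b c).
Proof.
move=> b0 c0 ab hc; set G := extremal_graph a b c in hc.
have a0 : 0 < a by lia.
have a1 : 1 < a by lia.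
pose x : G := inl (Ordinal a0); pose y : G := inl (Ordinal a1).
have [p [/and3P[sp Up /forallP Fp] lastp]] := hc x y isT.
have hs : hamilton_cycle (x :: p).
  apply/and4P; split => //; last exact/forallP.
    by rewrite size_full // card_extremal_graph; lia.
  by rewrite /= rcons_path lastp andbT.
apply: (no_extremal_cycle (k := 1) b0 c0 _ hs); first by lia.
rewrite card_gt0; apply/set0Pn; exists y; rewrite inE.
have -> : next (x :: p) y = x.
  case: (lastP p) Up lastp => [|q z]; first by [].
  by rewrite last_rcons => Up <-; apply: next_rcons.
by rewrite !inE.
Qed.

(** The forest is a path on [k + 1] clique vertices; a cycle containing it makes [k] steps inside
    the clique part. *)
Lemma extremal_not_k_edge_hamiltonian a b c k : 0 < b -> 0 < c -> a = b + k ->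
  ~ k_edge_hamiltonian k (extremal_graph a b c).
Proof.
move=> b0 c0 ab kh; set G := extremal_graph a b c in kh.
pose f : seq G := map inl (take k.+1 (enum 'I_a)).
have Uf : uniq f.
  by rewrite map_inj_uniq ?take_uniq ?enum_uniq // => x y [].
have sf : size f = k.+1.
  by rewrite size_map size_take size_enum_ord; case: ltnP; lia.
have fX x : x \in f -> x \in clique_part a b c by case/mapP => i _ ->; rewrite inE.
have lf : linear_forest [:: f].
  apply/and3P; split; last by rewrite /= cats0.
    by rewrite inE; apply/eqP => f0; rewrite -f0 in sf.
  rewrite /= andbT; apply: (@sub_in_sorted _ (mem f) [rel x y | x != y]); last first.
  - by apply: pairwise_sorted; rewrite -uniq_pairwise.
  - exact/allP.
  - by move=> x y /mapP[i _ ->] /mapP[j _ ->].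
have [|s [hs]] := kh [:: f] lf; first by rewrite /forest_size big_seq1 sf.
rewrite /= andbT => sfs; have /and4P[_ _ Us _] := hs.
apply: (no_extremal_cycle (k := k) b0 c0 _ hs); first by lia.
have := card_cycle_edge_sources Us Uf sfs; rewrite sf /= => /leq_trans; apply.
apply/subset_leq_card/subsetP => x; rewrite !inE => /andP[xf nf].
by have := fX _ xf; have := fX _ nf; rewrite !inE => -> ->.
Qed.

(** Deleting [k] clique vertices leaves [b] of them against [b] independent vertices. *)
Lemma extremal_not_k_hamiltonian a b c k : 0 < b -> 0 < c -> a = b + k ->
  ~ k_hamiltonian k (extremal_graph a b c).
Proof.
move=> b0 c0 ab kh; set G := extremal_graph a b c in kh.
pose S : {set G} := [set x : G | if x is inl i then (i : 'I_a) < k else false].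
have ka : k <= a by lia.
have cardS : #|S| = k.
  pose h (i : 'I_k) : G := inl (widen_ord ka i).
  have injh : injective h by move=> i j [] /val_inj.
  rewrite -[RHS]card_ord -(card_imset _ injh); apply: eq_card => -[i|x]; rewrite inE.
    apply/idP/imsetP => [ik|[j _ [->]]]; last exact: ltn_ord j.
    exists (Ordinal ik) => //.
    by congr inl; apply: val_inj.
  by apply/esym/imsetP => -[].
have [|s /and4P[_ cyc Us /forallP Fs]] := kh S; first by rewrite cardS.
have SX : S \subset clique_part a b c by apply/subsetP => -[x|x]; rewrite !inE.
have [z zW] := exists_other_part a b c0.
have zS : z \notin S.
  by apply: contra zW => zS; rewrite inE (subsetP SX).
pose pre (A : {set G}) : {set delete_vertices S} := [set x | val x \in A].
have cardpre A : #|pre A| = #|A :\: S|.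
  rewrite -(card_imset _ (@val_inj _ _ (delete_vertices S))); apply: eq_card => x; rewrite in_setD.
  apply/imsetP/andP => [[y + ->]|[xS xA]]; first by rewrite inE; split; first exact: (valP y).
  by exists (Sub x xS); rewrite ?inE ?SubK.
have cardX : #|pre (clique_part a b c)| = b.
  by rewrite cardpre cardsD (setIidPr SX) cardS card_clique_part; lia.
have cardY : #|pre (independent_part a b c)| = b.
  rewrite cardpre -[RHS](card_independent_part a b c); apply: eq_card => -[x|x]; rewrite !inE //.
  by rewrite andbF.
apply: (@no_spanning_cycle _ _ (pre (clique_part a b c))
  (pre (independent_part a b c)) (Sub z zS) s 0 (@adj_sym _) Us Fs cyc) => //.
- by move=> x y; rewrite [_ \in pre _]inE [_ \in pre _]inE; apply: independent_part_nbhd.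
- apply/pred0P => x /=; rewrite [_ \in pre _]inE [_ \in pre _]inE.
  exact: (pred0P (disjoint_parts a b c)).
- by rewrite cardY.
- by rewrite cardX cardY addn0.
- by move: zW; rewrite !in_setU [_ \in pre _]inE [_ \in pre _]inE SubK.
Qed.

(** * The bound and its tightness *)

Lemma GnlE n m i : 0 < i + m -> 2 * i + m <= n ->
  Gnl n (Posz m - 1)%R (Posz i) = extremal_graph (i + m - 1) i (n + 1 - m - 2 * i).
Proof.
move=> im imn; rewrite /Gnl /extremal_graph.
have -> : `|(Posz i + (Posz m - 1))%R|%N = i + m - 1 by lia.
have -> : `|Posz i|%N = i by [].
by have -> : `|(Posz n - 2 * Posz i - (Posz m - 1))%R|%N = n + 1 - m - 2 * i by lia.
Qed.

Lemma nstars_Gnl n m i t : 0 < t -> 0 < i -> 2 * i + m <= n ->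
  nstars t (Gnl n (Posz m - 1)%R (Posz i)) * (t == 1).+1 = extremal_sum n m t i.
Proof.
move=> t0 i0 imn; rewrite GnlE //; last by lia.
rewrite nstars_sum // sum_extremal_graph /extremal_sum.
by congr (_ * _ + _ * 'C(_, _) + _ * 'C(_, _)); lia.
Qed.

Theorem corollary8 (n t : nat) (l : int)
    (hl : ((-1 <= l) && (l <= Posz n - 3))%R) (ht : 1 <= t <= n - 1) :
  let i0 : int := ((Posz n - 1 - l)%R %/ 2)%Z in
  let bound : nat := maxn (nstars t (Gnl n l 1)) (nstars t (Gnl n l i0)) in
  (forall G : sgraph, #|G| = n ->
     (~ hamiltonian G /\ l = 0%R) \/
     (~ traceable G /\ l = (-1)%R) \/
     (~ hamiltonian_connected G /\ l = 1%R) \/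
     (exists k : nat,
        1 <= k <= n - 3 /\ ~ k_edge_hamiltonian k G /\ l = Posz k) \/
     (exists k : nat,
        1 <= k <= n - 3 /\ ~ k_hamiltonian k G /\ l = Posz k) ->
     nstars t G <= bound)
  /\ (l = 0%R -> exists G : sgraph,
        #|G| = n /\ ~ hamiltonian G /\ nstars t G = bound)
  /\ (l = (-1)%R -> exists G : sgraph,
        #|G| = n /\ ~ traceable G /\ nstars t G = bound)
  /\ (l = 1%R -> exists G : sgraph,
        #|G| = n /\ ~ hamiltonian_connected G /\ nstars t G = bound)
  /\ (forall k : nat, 1 <= k <= n - 3 -> l = Posz k -> exists G : sgraph,
        #|G| = n /\ ~ k_edge_hamiltonian k G /\ nstars t G = bound)
  /\ (forall k : nat, 1 <= k <= n - 3 -> l = Posz k -> exists G : sgraph,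
        #|G| = n /\ ~ k_hamiltonian k G /\ nstars t G = bound).
Proof.
move=> i0 bound; have t0 : 0 < t by case/andP: ht.
have [m lm] : exists m : nat, l = (Posz m - 1)%R by exists `|(l + 1)%R|%N; lia.
have mn : m.+2 <= n by lia.
have i0E : i0 = Posz ((n - m) %/ 2).
  rewrite /i0 lm -[Posz (_ %/ _)]divz_nat; congr divz; lia.
have [half_gt0 half_le] : 0 < (n - m) %/ 2 /\ 2 * ((n - m) %/ 2) + m <= n by lia.
have boundE : bound * (t == 1).+1 =
    maxn (extremal_sum n m t 1) (extremal_sum n m t ((n - m) %/ 2)).
  by rewrite /bound maxnMl i0E lm !nstars_Gnl //; lia.
(* The property fails on the extremal graphs for every admissible [i], so whichever of [1] and [i0]
   attains the maximum serves as witness. *)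
have tight (P : sgraph -> Prop) :
    (forall i, 0 < i -> 2 * i + m <= n ->
       P (extremal_graph (i + m - 1) i (n + 1 - m - 2 * i))) ->
    exists G : sgraph, #|G| = n /\ P G /\ nstars t G = bound.
  move=> Pext; have attained i : 0 < i -> 2 * i + m <= n ->
      nstars t (Gnl n l (Posz i)) = bound ->
      exists G : sgraph, #|G| = n /\ P G /\ nstars t G = bound.
    move=> ipos imn eq_bound; exists (Gnl n l (Posz i)); split; last split => //.
      by rewrite lm GnlE ?card_extremal_graph; lia.
    by rewrite lm GnlE; [apply: Pext | lia | lia].
  case: (leqP (nstars t (Gnl n l 1)) (nstars t (Gnl n l i0))) => [le|lt].
    by apply: (attained _ half_gt0 half_le); rewrite -i0E /bound (maxn_idPr le).
  by apply: (attained 1) => //; rewrite /bound (maxn_idPl (ltnW lt)).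
split; last split; last split; last split; last split.
- move=> G cardG notP; rewrite leqNgt; apply/negP => lt.
  (* More than [bound] stars exclude the degree condition with threshold [n + l]; each case then
     derives its property from this. *)
  have nore k : k.+1 = n + m -> ~ ore_bounded k (@adj G).
    move=> km ore; move: lt; rewrite ltnNge => /negP[].
    rewrite -(leq_pmul2r (ltn0Sn (t == 1))) boundE nstars_sum // -cardG.
    by apply: (ore_bounded_sum _ (k := k)); rewrite ?cardG.
  case: notP => [[nP l0]|[[nP l0]|[[nP l0]|[[k [kn [nP l0]]]|[k [kn [nP l0]]]]]]]; apply: nP.
  + by apply: hamiltonian_of_ore; [lia | apply: nore; lia].
  + by apply: (@traceable_of_ore _ n.-1); [lia | lia | apply: nore; lia].
  + by apply: hamiltonian_connected_of_ore; [lia | apply: nore; lia].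
  + by apply: k_edge_hamiltonian_of_ore; [lia | apply: nore; lia].
  + by apply: k_hamiltonian_of_ore; [lia | apply: nore; lia].
- by move=> l0; apply: tight => i ipos imn; apply: extremal_not_hamiltonian; lia.
- by move=> l0; apply: tight => i ipos imn; apply: extremal_not_traceable; lia.
- by move=> l0; apply: tight => i ipos imn; apply: extremal_not_hamiltonian_connected; lia.
- by move=> k kn l0; apply: tight => i ipos imn; apply: extremal_not_k_edge_hamiltonian; lia.
- by move=> k kn l0; apply: tight => i ipos imn; apply: extremal_not_k_hamiltonian; lia.
Qed.
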